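(* Let $X$ be a graph and let $a,b\in V(X)$. The vertices $a$ and $b$ are cospectral if and only if there is an orthogonal symmetry $Q$ of $X$ such that $Q^2=I$ and $Qe_a=e_b$.
   Context: Graphs are finite, simple and undirected. Let $A$ be the adjacency matrix of $X$ and let $e_a$ ($a\in V(X)$) be the standard basis vectors of $\mathbb{R}^{V(X)}$. An orthogonal symmetry of $X$ is a real orthogonal matrix (rows and columns indexed by $V(X)$) that commutes with $A$. Vertices $a,b$ are cospectral if the vertex-deleted subgraphs $X\setminus a$ and $X\setminus b$ have adjacency matrices with the same characteristic polynomial. *)

(* Defs.v *)
From HB Require Import structures.
From mathcomp Require Import all_boot all_order all_algebra.
From mathcomp Require Import reals.

Set Implicit Arguments.
Unset Strict Implicit.
Unset Printing Implicit Defensive.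

Import Order.TTheory GRing.Theory Num.Theory.
Local Open Scope ring_scope.

Record sgraph := SGraph {
  vertex :> finType;
  adj : rel vertex;
  adj_sym : symmetric adj;
  adj_irrefl : irreflexive adj
}.

Section VertexDeletion.
Variables (X : sgraph) (a : X).

Definition del_adj : rel {x : X | x != a} := fun u v => adj (val u) (val v).

Lemma del_adj_sym : symmetric del_adj.
Proof. by move=> u v; apply: adj_sym. Qed.

Lemma del_adj_irrefl : irreflexive del_adj.
Proof. by move=> u; apply: adj_irrefl. Qed.

Definition del_vertex : sgraph := SGraph del_adj_sym del_adj_irrefl.

End VertexDeletion.

(* Matrices are indexed by ordinals: the vertex x has index [enum_rank x],
   and the index i stands for the vertex [enum_val i]. *)
Definition adjmx (R : realType) (X : sgraph) : 'M[R]_#|X| :=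
  \matrix_(i, j) (adj (enum_val i) (enum_val j))%:R.

Definition vertex_vec (R : realType) (X : sgraph) (a : X) : 'cV[R]_#|X| :=
  delta_mx (enum_rank a) 0.

Definition orthogonal_mx (R : realType) (n : nat) (Q : 'M[R]_n) : Prop :=
  Q^T *m Q = 1%:M.

Definition orthogonal_symmetry (R : realType) (X : sgraph)
    (Q : 'M[R]_#|X|) : Prop :=
  orthogonal_mx Q /\ comm_mx Q (adjmx R X).

Definition cospectral (R : realType) (X : sgraph) (a b : X) : Prop :=
  char_poly (adjmx R (del_vertex a)) = char_poly (adjmx R (del_vertex b)).

(* Main.v *)
Require Import Defs.
From mathcomp Require Import all_boot all_order all_algebra.
From mathcomp Require Import reals.
From mathcomp Require Import fingroup perm.

(** Let C = 'X - A be the characteristic matrix and B = adj C.  The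
    characteristic polynomial of X \ a is the cofactor B_aa
    ([char_poly_del_vertex]), so a and b are cospectral iff B_aa = B_bb.

    An orthogonal Q commuting with A also commutes with B
    ([adj_char_poly_comm]); hence if Q e_a = e_b then
    B_bb = e_a^T Q^T B Q e_a = B_aa.

    Conversely, write B = \sum_k B_k 'X^k.  Each B_k is symmetric, so if
    B_aa = B_bb then
      (e_a - e_b)^T B_k (e_a + e_b) = (B_k)_aa - (B_k)_bb = 0
    for all k.  Let W be the span of the vectors B_k (e_a - e_b).  Comparing
    coefficients in B C = det C gives B_k.+1 A = B_k - c_k.+1, where c_k are the
    coefficients of the characteristic polynomial, together with
    B_0 A = - c_0 and B_(n-1) = 1; so W is A-stable and contains e_a - e_b,
    that is, W is the cyclic subspace that e_a - e_b generates, and it is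
    orthogonal to e_a + e_b.  Since A is symmetric, the orthogonal projection
    P on W commutes with A, and so does the involution Q = 1 - 2P
    ([stable_reflection]).  It negates e_a - e_b and fixes e_a + e_b, so it
    sends e_a to e_b.

    Using the coefficients of B in place of the powers of A gives the cyclic
    subspace directly from the polynomial identity B_aa = B_bb, with no need to
    convert it into the equality of the numbers of closed walks at a and b. *)

Set Implicit Arguments.
Unset Strict Implicit.
Unset Printing Implicit Defensive.

Import GRing.Theory Num.Theory.
Local Open Scope ring_scope.

(** * Deleting a vertex and the adjugate of the characteristic matrix *)

(** The dimensions are only propositionally equal, as needed to compare
    matrices indexed by the vertices of a deleted subgraph with minors. *)
Lemma det_mxsub_inj (R : comNzRingType) (m n : nat) (f : 'I_m -> 'I_n)
    (A : 'M[R]_n) :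
  m = n -> injective f -> \det (mxsub f f A) = \det A.
Proof.
move=> eq_mn; move: f; rewrite eq_mn => f f_inj.
have -> : mxsub f f A = row_perm (perm f_inj) (col_perm (perm f_inj) A).
  by apply/matrixP => i j; rewrite !mxE !permE.
rewrite row_permE col_permE !det_mulmx !det_perm odd_permV.
by rewrite mulrCA -signr_addb addbb mulr1.
Qed.

(** The two determinants have the same entries up to a bijection of indices:
    [f] sends the index of a vertex x != a of the deleted subgraph to its
    position once the row and column of a are struck out. *)
Lemma char_poly_del_vertex (R : realType) (X : sgraph) (a : X) :
  char_poly (adjmx R (del_vertex a))
  = (\adj (char_poly_mx (adjmx R X))) (enum_rank a) (enum_rank a).
Proof.
set ia := enum_rank a.
pose g (k : 'I_#|del_vertex a|) : 'I_#|X| := enum_rank (val (enum_val k)).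
have g_inj : injective g.
  by move=> i j /enum_rank_inj /val_inj /enum_val_inj.
have ia_neq k : ia != g k.
  by rewrite (inj_eq enum_rank_inj) eq_sym; apply: (valP (enum_val k)).
pose f k := sval (unlift_some (ia_neq k)).
have fE k : lift ia (f k) = g k.
  by rewrite /f; case: (unlift_some (ia_neq k)).
have f_inj : injective f.
  by move=> i j fij; apply: g_inj; rewrite -!fE fij.
have card_del : #|del_vertex a| = #|X|.-1.
  by rewrite card_sig (cardC1 a).
rewrite !mxE /cofactor addnn -signr_odd odd_double mul1r.
rewrite -(det_mxsub_inj _ card_del f_inj) /char_poly; congr (\det _).
apply/matrixP => i j; rewrite !mxE !fE (inj_eq g_inj).
by rewrite /g !enum_rankK.
Qed.

(** * Coefficients of the adjugate *)

Section AdjugateCoefficients.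

Variables (R : comNzRingType) (n : nat) (A : 'M[R]_n).

Definition adj_coef (k : nat) : 'M[R]_n :=
  map_mx (coefp k) (\adj (char_poly_mx A)).

Let adj_char_polyE (i j : 'I_n) :
  (\adj (char_poly_mx A)) i j * 'X
  - \sum_l (\adj (char_poly_mx A)) i l * (A l j)%:P
  = char_poly A *+ (i == j).
Proof.
have /matrixP/(_ i j) := mul_adj_mx (char_poly_mx A).
by rewrite /char_poly_mx mulmxBr mul_mx_scalar !mxE mulrC => <-; congr (_ - _);
   apply: eq_bigr => l _; rewrite !mxE.
Qed.

Lemma adj_coef0 : adj_coef 0 *m A = - ((char_poly A)`_0)%:M.
Proof.
apply/matrixP => i j; have /(congr1 (coefp 0)) := adj_char_polyE i j.
rewrite /= coefB coefMX coefMn coef_sum sub0r !mxE => <-; rewrite opprK.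
by apply: eq_bigr => l _; rewrite coefMC !mxE.
Qed.

Lemma adj_coefS k :
  adj_coef k.+1 *m A = adj_coef k - ((char_poly A)`_k.+1)%:M.
Proof.
apply/matrixP => i j; have /(congr1 (coefp k.+1)) := adj_char_polyE i j.
rewrite /= coefB coefMX coefMn coef_sum !mxE => <-; rewrite opprB addrC subrK.
by apply: eq_bigr => l _; rewrite coefMC !mxE.
Qed.

Lemma adj_coef_sym k : A^T = A -> (adj_coef k)^T = adj_coef k.
Proof.
move=> A_sym; rewrite /adj_coef map_trmx trmx_adj /char_poly_mx.
by rewrite linearB /= tr_scalar_mx map_trmx A_sym.
Qed.

(** Above the degree of the characteristic polynomial, B_k = B_k.+1 A; as
    B_k = 0 for k above the degrees of all entries, these coefficients all vanish. *)
Lemma adj_coef_eq0 k : (n <= k)%N -> adj_coef k = 0.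
Proof.
move=> le_nk; pose N := \max_i \max_j size ((\adj (char_poly_mx A)) i j).
have large m : (N <= m)%N -> adj_coef m = 0.
  move=> leNm; apply/matrixP => i j; rewrite mxE [RHS]mxE /= nth_default //.
  apply: leq_trans leNm; apply: leq_trans (leq_bigmax i).
  exact: (leq_bigmax j).
suff vanish d : adj_coef (k + d) = 0 -> adj_coef k = 0.
  by apply: (vanish N); apply: large; apply: leq_addl.
elim: d => [|d IHd]; first by rewrite addn0.
rewrite addnS => kd0; apply: IHd; have := adj_coefS (k + d).
rewrite kd0 mul0mx nth_default; first by rewrite raddf0 subr0.
by rewrite size_char_poly ltnS (leq_trans le_nk) ?leq_addr.
Qed.

(** The recurrence gives 0 = B_n A = B_(n-1) - c_n, and c_n = 1. *)
Lemma adj_coef_last : (0 < n)%N -> adj_coef n.-1 = 1%:M.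
Proof.
move=> n_gt0; have := adj_coefS n.-1.
rewrite prednK // adj_coef_eq0 // mul0mx => /esym/eqP.
rewrite subr_eq0 => /eqP ->; have /monicP := char_poly_monic A.
by rewrite lead_coefE size_char_poly => ->.
Qed.

(** If P commutes with C, then det C * (P adj C) = adj C * C * P * adj C
    = adj C * P * C * adj C = det C * (adj C P), and det C is monic, hence not a zero divisor. *)
Lemma adj_char_poly_comm (Q : 'M[R]_n) :
  comm_mx Q A ->
  comm_mx (map_mx polyC Q) (\adj (char_poly_mx A)).
Proof.
move=> QA; set C := char_poly_mx A; set P := map_mx _ Q.
have PC : P *m C = C *m P.
  rewrite /C /char_poly_mx mulmxBr mulmxBl -!map_mxM QA.
  by rewrite mul_mx_scalar mul_scalar_mx.
have det_reg : GRing.lreg (\det C).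
  by apply: monic_lreg; apply: char_poly_monic.
have /matrixP E : \det C *: (P *m \adj C) = \det C *: (\adj C *m P).
  rewrite -mul_scalar_mx -mul_adj_mx -mulmxA (mulmxA C) -PC -!mulmxA mul_mx_adj.
  by rewrite mul_mx_scalar -scalemxAr.
apply/matrixP => i j; apply: det_reg.
by have := E i j; rewrite !mxE.
Qed.

(** (Q e_i)^T B (Q e_i) = e_i^T Q^T Q B e_i, with B the adjugate, once Q is
    lifted to constant polynomials. *)
Lemma adj_diag_orthogonal (Q : 'M[R]_n) (i j : 'I_n) :
  Q^T *m Q = 1%:M -> comm_mx Q A ->
  Q *m delta_mx i (0 : 'I_1) = delta_mx j 0 ->
  (\adj (char_poly_mx A)) i i = (\adj (char_poly_mx A)) j j.
Proof.
move=> QtQ QA Qi; set B := \adj _; pose P := map_mx polyC Q.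
pose e k : 'cV[{poly R}]_n := delta_mx k 0.
have PB : P *m B = B *m P := adj_char_poly_comm QA.
have Pi : P *m e i = e j.
  rewrite /P /e -(map_delta_mx (polyC : R -> {poly R})) -map_mxM Qi.
  by rewrite map_delta_mx.
have PtP : P^T *m P = 1%:M by rewrite /P map_trmx -map_mxM QtQ map_mx1.
have diagE k : (e k)^T *m B *m e k = (B k k)%:M.
  by rewrite [LHS]mx11_scalar trmx_delta -rowE -colE !mxE.
have : (B i i)%:M = (B j j)%:M :> 'M_1.
  rewrite -!diagE -Pi trmx_mul -!mulmxA (mulmxA B) -PB.
  by rewrite -(mulmxA P) (mulmxA P^T) PtP mul1mx.
by move=> /matrixP/(_ 0 0); rewrite !mxE !mulr1n.
Qed.

End AdjugateCoefficients.

(** * Reflections in invariant subspaces *)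

Section Reflection.

Variables (R : realFieldType) (n : nat).

Lemma row_gram_eq0 m (u : 'rV[R]_m) : u *m u^T = 0 -> u = 0.
Proof.
move=> /matrixP/(_ 0 0); rewrite !mxE => uu0; apply/matrixP => i j.
rewrite ord1 mxE; apply/eqP; rewrite -sqrf_eq0 expr2; apply/eqP.
have sq_ge0 (k : 'I_m) : true -> 0 <= u 0 k * u^T k 0.
  by rewrite mxE -expr2 sqr_ge0.
by have := psumr_eq0P sq_ge0 uu0 (i := j) isT; rewrite mxE.
Qed.

(** A vector x killed by M M^T satisfies |x M|^2 = 0. *)
Lemma gram_unit m (M : 'M[R]_(m, n)) : row_free M -> M *m M^T \in unitmx.
Proof.
move=> Mfree; rewrite -row_free_unit -kermx_eq0; apply/eqP/row_matrixP => i.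
rewrite row0; have : row i (kermx (M *m M^T)) *m (M *m M^T) = 0.
  by rewrite -row_mul mulmx_ker row0.
set x := row i _ => xG0; apply: (row_free_inj Mfree); rewrite mul0mx.
by apply: row_gram_eq0; rewrite trmx_mul mulmxA -(mulmxA x) xG0 mul0mx.
Qed.

(** Q = 1 - 2P with P = M^T (M M^T)^-1 M, the orthogonal projection on the row
    space of W, where M is a basis of it.  Writing M A = K M for the action of
    A on this basis, symmetry of A makes K self-adjoint for the Gram matrix,
    K G = G K^T, which is what P A = A P amounts to. *)
Lemma stable_reflection m (A : 'M[R]_n) (W : 'M[R]_(m, n)) :
  A^T = A -> stablemx W A ->
  exists Q : 'M[R]_n,
    [/\ Q^T = Q, Q *m Q = 1%:M, comm_mx Q A, W *m Q = - W &
        forall u : 'cV[R]_n, W *m u = 0 -> Q *m u = u].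
Proof.
move=> A_sym W_stable.
have [M Mfree eqMW] :
    exists2 M : 'M[R]_(\rank W, n), row_free M & (M :=: W)%MS.
  by exists (row_base W); [apply: row_base_free | apply: eq_row_base].
pose G := M *m M^T.
have G_unit : G \in unitmx by apply: gram_unit.
have G_sym : G^T = G by rewrite trmx_mul trmxK.
have [K MA] : exists K, M *m A = K *m M.
  by apply/submxP; rewrite -/(stablemx M A) (eqmx_stable _ eqMW).
have AMt : A *m M^T = M^T *m K^T by rewrite -trmx_mul -MA trmx_mul A_sym.
have KG : K *m G = G *m K^T by rewrite /G mulmxA -MA -!mulmxA AMt.
have KGi : invmx G *m K = K^T *m invmx G.
  apply: (can_inj (mulKmx G_unit)); rewrite mulKVmx //.
  by rewrite mulmxA -KG mulmxK.
pose P := M^T *m invmx G *m M.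
have MP : M *m P = M by rewrite /P !mulmxA mulmxV // mul1mx.
have [L WE] : exists L, W = L *m M by apply/submxP; rewrite eqMW.
have [L' ME] : exists L', M = L' *m W by apply/submxP; rewrite eqMW.
have WP : W *m P = W by rewrite WE -mulmxA MP.
have PP : P *m P = P by rewrite {1}/P -mulmxA MP.
have P_sym : P^T = P.
  by rewrite /P !trmx_mul trmxK trmx_inv G_sym mulmxA.
have PA : P *m A = A *m P.
  by rewrite /P !mulmxA AMt -[LHS]mulmxA MA -!mulmxA (mulmxA _ K) KGi !mulmxA.
exists (1%:M - (P + P)); split.
- by rewrite linearB linearD /= trmx1 P_sym.
- rewrite mulmxBr mulmx1 mulmxBl mul1mx mulmxDl !mulmxDr PP.
  by rewrite opprB addrK subrK.
- by rewrite /comm_mx mulmxBl mulmxBr mul1mx mulmx1 mulmxDl mulmxDr PA.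
- by rewrite mulmxBr mulmx1 mulmxDr WP opprD addrA subrr sub0r.
- move=> u Wu0; have Pu0 : P *m u = 0.
    by rewrite /P -mulmxA [X in _ *m (X *m u)]ME -(mulmxA L') Wu0 !mulmx0.
  by rewrite mulmxBl mul1mx mulmxDl Pu0 addr0 subr0.
Qed.

(** The A-stable subspace generated by v: stability is the recurrence for the
    coefficients of the adjugate, and v occurs as the row for k = n - 1. *)
Lemma adj_coef_span_stable (A : 'M[R]_n) (v : 'rV[R]_n)
    (W := \matrix_(i < n) (v *m adj_coef A i)) :
  (v <= W)%MS /\ stablemx W A.
Proof.
have rowW (i : 'I_n) : (v *m adj_coef A i <= W)%MS.
  by rewrite -[v *m _](rowK (fun i => v *m adj_coef A i)) row_sub.
have vW : (v <= W)%MS.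
  have [n_gt0|] := ltnP 0 n; last first.
    rewrite leqn0 => /eqP n0.
    suff -> : v = 0 by rewrite sub0mx.
    by apply/rowP => i; have := ltn_ord i; rewrite {2}n0.
  have lt_n : (n.-1 < n)%N by rewrite ltn_predL.
  by have := rowW (Ordinal lt_n); rewrite /= adj_coef_last // mulmx1.
split=> //; apply/row_subP => -[i lt_in]; rewrite row_mul rowK -mulmxA /=.
case: i lt_in => [|k] lt_kn.
  by rewrite adj_coef0 mulmxN mul_mx_scalar -scaleNr scalemx_sub.
rewrite adj_coefS mulmxBr mul_mx_scalar addmx_sub //.
  exact: (rowW (Ordinal (ltnW lt_kn))).
by rewrite -scaleNr scalemx_sub.
Qed.

(** The reflection negates the cyclic subspace of e_i - e_j; equality of the
    diagonal entries says that e_i + e_j is orthogonal to this subspace. *)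
Lemma adj_diag_reflection (A : 'M[R]_n) (i j : 'I_n) :
  A^T = A ->
  (\adj (char_poly_mx A)) i i = (\adj (char_poly_mx A)) j j ->
  exists Q : 'M[R]_n,
    [/\ Q^T *m Q = 1%:M /\ comm_mx Q A, Q *m Q = 1%:M &
        Q *m delta_mx i (0 : 'I_1) = delta_mx j 0].
Proof.
move=> A_sym diag_eq.
(* Both summands of 2 e_i = (e_i + e_j) + (e_i - e_j) are eigenvectors of Q. *)
pose ei : 'cV[R]_n := delta_mx i 0; pose ej : 'cV[R]_n := delta_mx j 0.
have [vW W_stable] := adj_coef_span_stable A (ei - ej)^T.
set W := (X in (_ <= X)%MS) in vW W_stable.
have [Q [Q_sym QQ QA WQ Qfix]] := stable_reflection A_sym W_stable.
have Qplus : Q *m (ei + ej) = ei + ej.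
  apply: Qfix; apply/row_matrixP => k; rewrite row_mul rowK row0.
  have B_sym := adj_coef_sym k A_sym.
  have B_diag : adj_coef A k i i = adj_coef A k j j.
    by rewrite [LHS]mxE diag_eq [RHS]mxE.
  (* The diagonal terms cancel by hypothesis, the cross terms by symmetry. *)
  move: (adj_coef A k) B_sym B_diag => B /matrixP/(_ i j); rewrite mxE.
  move=> B_off B_diag; rewrite [LHS]mx11_scalar linearB /= !trmx_delta.
  rewrite !mulmxBl !mulmxDr -!rowE -!colE !mxE B_diag B_off.
  by rewrite [B j j + _]addrC subrr raddf0.
have Qminus : Q *m (ei - ej) = - (ei - ej).
  have [L vE] := submxP vW.
  apply: trmx_inj; rewrite trmx_mul Q_sym vE -mulmxA WQ mulmxN -vE.
  by rewrite linearN.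
exists Q; rewrite Q_sym; split=> //.
have two_neq0 : 2%:R != 0 :> R by rewrite pnatr_eq0.
apply/(can_inj (scalerK two_neq0)); rewrite !scaler_nat -/ei -/ej.
have -> : (Q *m ei) *+ 2 = Q *m (ei + ej) + Q *m (ei - ej).
  by rewrite -mulmxDr addrACA subrr addr0 mulmxDr mulr2n.
by rewrite Qplus Qminus opprB addrC addrA addrNK.
Qed.

End Reflection.

(** * Cospectral vertices *)

Lemma adjmx_sym (R : realType) (X : sgraph) : (adjmx R X)^T = adjmx R X.
Proof. by apply/matrixP => i j; rewrite !mxE adj_sym. Qed.

Theorem lemma11p1 (R : realType) (X : sgraph) (a b : X) :
  cospectral R a b <->
  exists Q : 'M[R]_#|X|,
    [/\ orthogonal_symmetry Q,
        Q *m Q = 1%:M &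
        Q *m vertex_vec R a = vertex_vec R b].
Proof.
rewrite /cospectral !char_poly_del_vertex.
split=> [|[Q [[QtQ QA] _ Qab]]].
  exact: adj_diag_reflection (adjmx_sym R X).
exact: adj_diag_orthogonal QtQ QA Qab.
Qed.
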